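(* Let $n$ and $k$ be positive integers. There is a one-to-one correspondence between words of length $k$ with entries in $[n]$ and pairs $(S,T)$ satisfying: $S$ and $T$ are tableaux of the same shape; $S$ is a standard Young tableau of size $n$; and $T$ is a standard multiset tableau of content $[k]$.
   Context: $[k]=\{1,\ldots,k\}$. Multisets over $[k]$ (the empty multiset is allowed) are compared in graded lexicographic order: if $M=\{\!\{a_1\le\cdots\le a_r\}\!\}$ and $M'=\{\!\{a'_1\le\cdots\le a'_t\}\!\}$, then $M<M'$ if $r<t$, or if $r=t$ and there is $i$ with $a_1=a'_1,\ldots,a_{i-1}=a'_{i-1}$ and $a_i<a'_i$. The diagram of a partition $\lambda=(\lambda_1\ge\cdots\ge\lambda_r>0)$ has $\lambda_j$ left-justified cells in row $j$. A semistandard multiset tableau of shape $\lambda$ is a filling of the cells of $\lambda$ by multisets over $[k]$ (empty multiset allowed) such that entries weakly increase along each row from left to right, and strictly increase in each column when passing from row $j$ to row $j+1$. Its content is the multiset union (multiplicities added) of all its entries. A standard multiset tableau of content $[k]$ is a semistandard multiset tableau whose content is the set $[k]$, i.e. each letter $1,\ldots,k$ appears exactly once in the whole tableau (while the empty set may label several cells). A standard Young tableau of size $n$ is a filling of the diagram of a partition of $n$ by $1,\ldots,n$, each used exactly once, strictly increasing along rows (left to right) and along columns (from row $j$ to row $j+1$). *)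

(* Defs.v *)
From mathcomp Require Import all_boot all_order.
From mathcomp Require Import finmap multiset.

Set Implicit Arguments.
Unset Strict Implicit.
Unset Printing Implicit Defensive.

Local Open Scope mset_scope.
Local Open Scope nat_scope.

(* The alphabet [k] = {1, ..., k} is 'I_k with its usual order: the letter i is
   the ordinal of value i.-1. *)

Section GradedLex.
Variable k : nat.
Implicit Types M N : {mset 'I_k}.

Definition mset_word M : seqlexi 'I_k := sort Order.le M.

Definition grlex_lt M N : bool :=
  (size M < size N)
  || (size M == size N) && (mset_word M < mset_word N)%O.

Definition grlex_le M N : bool := (M == N) || grlex_lt M N.

(* On words of equal length, the order of seqlexi is decided by the first
   position where the words differ. *)
Lemma grlex_ltP M N :
  let a := mset_word M in let b := mset_word N in
  reflect (size a < size b \/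
           size a = size b /\
           exists2 i, i < size a &
             (forall j x0, j < i -> nth x0 a j = nth x0 b j) /\
             (forall x0, nth x0 a i < nth x0 b i))
          (grlex_lt M N).
Proof.
move=> a b.
have -> : grlex_lt M N = (size a < size b) || (size a == size b) && (a < b)%O.
  by rewrite /grlex_lt /a /b !size_sort.
have lexP (s t : seqlexi 'I_k) : size s = size t ->
    (s < t)%O <-> exists2 i, i < size s &
      (forall j x0, j < i -> nth x0 s j = nth x0 t j) /\
      (forall x0, nth x0 s i < nth x0 t i).
  elim: s t => [|x s IHs] [|y t] //=; first by split=> // -[].
  move=> [/IHs{}IHs]; rewrite Order.SeqLexiOrder.ltxi_cons; split.
    case/andP=> le_xy /implyP lt_st.
    have [xy|/negP] := boolP (y <= x)%O; last first.
      move/negP=> nyx; exists 0 => //; split=> // x0 /=.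
      by rewrite ltnNge.
    have [i lti [Eq Lt]] := (IHs.1 (lt_st xy)); exists i.+1 => //; split=> //.
    move=> [|j] x0 /= ltj; last exact: Eq.
    by apply: Order.POrderTheory.le_anti; rewrite le_xy.
  move=> [[|i] lti [Eq Lt]].
    have /= lt_xy := Lt x.
    by rewrite !Order.OrdinalOrder.leEord (ltnW lt_xy) leqNgt lt_xy.
  have /= -> := Eq 0 x isT; rewrite Order.POrderTheory.lexx /=; apply/IHs; exists i => //.
  by split=> [j x0 ltj|x0]; [exact: (Eq j.+1) | exact: (Lt x0)].
apply: (iffP orP) => -[|]; try by left.
  by case/andP=> /eqP sz /(lexP _ _ sz); right.
by case=> sz H; right; rewrite sz eqxx; apply/lexP.
Qed.

End GradedLex.

Definition is_partition (la : seq nat) : bool := sorted geq la && (0 \notin la).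

(* A filling of a diagram is the sequence of its rows; its shape is seq.shape.
   As zip truncates to the shorter (lower) row, col_rel is tested on exactly the
   pairs of vertically adjacent cells. *)
Definition is_tableau (A : Type) (row_rel col_rel : rel A) (t : seq (seq A)) :=
  [&& is_partition (shape t),
      all (sorted row_rel) t &
      sorted (fun r s => all (fun p => col_rel p.1 p.2) (zip r s)) t].

Definition is_standard_tableau (n : nat) (S : seq (seq nat)) : bool :=
  is_tableau ltn ltn S && perm_eq (flatten S) (iota 1 n).

Section MultisetTableaux.
Variable k : nat.
Implicit Type T : seq (seq {mset 'I_k}).

Definition is_semistandard_mset_tableau T : bool :=
  is_tableau (@grlex_le k) (@grlex_lt k) T.

Definition mset_content T : {mset 'I_k} :=
  \big[msetD/mset0]_(M <- flatten T) M.

Definition is_standard_mset_tableau T : bool :=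
  is_semistandard_mset_tableau T
  && (mset_content T == seq_mset (enum 'I_k)).

End MultisetTableaux.

Definition tableau_pair (n k : nat) : Type :=
  {ST : seq (seq nat) * seq (seq {mset 'I_k}) |
    [&& shape ST.1 == shape ST.2,
        is_standard_tableau n ST.1 &
        is_standard_mset_tableau ST.2]}.

(* Main.v *)
From HB Require Import structures.
Require Import Defs.
From mathcomp Require Import all_boot all_order.
From mathcomp Require Import finmap multiset.

Set Implicit Arguments.
Unset Strict Implicit.
Unset Printing Implicit Defensive.

(** A word u over the letters 1, ..., n with k positions is the same thing as
    the sequence (B_1, ..., B_n) of its fibres, B_j being the set of positions
    where u has the letter j ([blocks], [blocks_inj], [exists_blocks]).  The
    sequences that arise are the words of length n over the ordered alphabet
    of multisets whose letters add up to {1, ..., k}.  Graded lexicographic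
    order is total, so the Robinson-Schensted-Knuth correspondence applies to
    such words.  It sends them bijectively to pairs of tableaux of the same
    shape of size n, one standard, the other semistandard with the letters of
    the word as entries; equality of the multisets of entries turns the
    condition on the sum of the blocks into the condition on the content.

    The correspondence is built one letter at a time.  Inserting x in a row
    replaces the leftmost entry y > x, and y is then inserted in the next row;
    when there is no such y, the row gets a new cell at its end and the
    process stops.  This preserves semistandardness ([insert_tab]) and adds
    one cell to the shape ([shape_insert]).  A tableau together with the row
    of the new cell determines the previous tableau and the inserted letter
    ([insert_inj]), and every removable cell of every tableau is obtained
    ([exists_insert]); both facts reduce to one row, where the replaced entry
    is located as the rightmost one below the letter that was bumped out.
    The standard tableau records the order in which cells appear: its largest
    entry sits in a removable cell, which gives the row to be undone
    ([exists_add_cell], [add_cell_inj]).  Induction on the length of the word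
    then gives injectivity ([rsk_inj]) and surjectivity ([exists_rsk]). *)

Import Order.TTheory.
Local Open Scope mset_scope.
Local Open Scope nat_scope.

(** * Tableaux as stacks of rows *)

Section Tableaux.
Variables (A : eqType) (row_rel col_rel : rel A).
Implicit Types (r s : seq A) (t : seq (seq A)).

Definition dominates r s :=
  (size s <= size r) && all (fun p => col_rel p.1 p.2) (zip r s).

Lemma dominatesP x0 r s :
  reflect (size s <= size r /\
           forall l, l < size s -> col_rel (nth x0 r l) (nth x0 s l))
          (dominates r s).
Proof.
rewrite /dominates; elim: s r => [|y s IHs] [|x r] /=.
- by constructor.
- by constructor.
- by constructor; case.
rewrite ltnS andbCA; apply: (iffP andP) => [[xy /IHs[le_sr H]]|[le_sr H]].
  by split=> // -[].
split; first exact: (H 0).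
by apply/IHs; split=> // l; apply: (H l.+1).
Qed.

Lemma dominates_nil r : dominates r [::].
Proof. by case: r. Qed.

(** Only adjacent rows are compared, so that removing or modifying the first
    row leaves a condition on the other rows that is suited to induction; an
    absent next row counts as empty. *)
Fixpoint tab t : bool :=
  if t is r :: t' then
    [&& r != [::], sorted row_rel r, dominates r (head [::] t') & tab t']
  else true.

Lemma is_tableauE t : is_tableau row_rel col_rel t = tab t.
Proof.
rewrite /is_tableau /is_partition; elim: t => //= r [|s t] /= IHt.
  by rewrite !andbT dominates_nil /= inE eq_sym size_eq0 andbT.
rewrite -IHt inE negb_or eq_sym size_eq0 /dominates.
case: (r != [::]); last by rewrite /= !andbF.
case: (sorted _ r) => /=; last by rewrite !andbF.
by case: (size s <= size r); case: (all _ (zip r s)) => //=; rewrite !andbF.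
Qed.

Lemma tab_shape t : tab t -> is_partition (shape t).
Proof. by rewrite -is_tableauE => /and3P[]. Qed.

End Tableaux.

(** Rows beyond the last one have length 0, so the end of the last row is a
    corner as well. *)
Definition corner (sh : seq nat) j := nth 0 sh j.+1 < nth 0 sh j.

(** Without the condition on 0, trailing zeros could differ: adding a cell in
    row 1 to the shapes [::] and [:: 0] gives the same shape. *)
Lemma incr_nth_partition_inj j s1 s2 : 0 \notin s1 -> 0 \notin s2 ->
  incr_nth s1 j = incr_nth s2 j -> s1 = s2.
Proof.
have le_size u v : 0 \notin u -> nth 0 u =1 nth 0 v -> size u <= size v.
  move=> u0 uv; rewrite leqNgt; apply: contra u0 => lt_vu.
  by rewrite -(nth_default 0 (leqnn (size v))) -uv mem_nth.
move=> s10 s20 /(congr1 (nth 0)) eq12.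
have eq_nth : nth 0 s1 =1 nth 0 s2.
  by move=> i; have := congr1 (@^~ i) eq12; rewrite !nth_incr_nth => /addnI.
apply: (@eq_from_nth _ 0) => // ; apply/eqP.
by rewrite eqn_leq !le_size // => i; rewrite eq_nth.
Qed.

(** * Inserting a letter in one row *)

Section RowInsertion.
Variables (disp : Order.disp_t) (A : orderType disp).
Implicit Types (r s h : seq A) (x y z : A).
Local Notation row := (sorted (@Order.le disp A)).
Local Notation dom := (dominates (@Order.lt disp A)).

Lemma row_leP x0 r :
  row r <-> forall i j, i <= j -> j < size r -> (nth x0 r i <= nth x0 r j)%O.
Proof.
split=> [/(sorted_leq_nth le_trans lexx) H i j le_ij lt_j|H].
  by apply: H => //; rewrite inE // (leq_ltn_trans le_ij).
by apply/(sortedP x0) => i lt_i; apply: H.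
Qed.

(** Equal to [size r] when no entry exceeds [x], which is the index at which
    [set_nth] extends the row. *)
Definition bump_index r x := find (fun z => (x < z)%O) r.

Lemma bump_index_size r x : bump_index r x <= size r.
Proof. exact: find_size. Qed.

Lemma lt_nth_rowE x0 r x l : row r -> l < size r ->
  (x < nth x0 r l)%O = (bump_index r x <= l).
Proof.
move=> /(row_leP x0) r_le lt_l; case: leqP => [le_pl|/(before_find x0)//].
apply: lt_le_trans (r_le _ _ le_pl lt_l).
by apply: (nth_find x0 (a := fun z => (x < z)%O)); rewrite has_find (leq_ltn_trans le_pl).
Qed.

Arguments lt_nth_rowE x0 {r x l}.

Lemma bump_index_unique x0 r x i : row r -> i <= size r ->
  (forall l, l < size r -> (x < nth x0 r l)%O = (i <= l)) -> bump_index r x = i.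
Proof.
move=> rr le_i H; apply/eqP; rewrite eqn_leq; apply/andP; split.
  have [->|] := eqVneq i (size r); first exact: bump_index_size.
  move=> ne; have lt_i : i < size r by rewrite ltn_neqAle ne.
  by rewrite -(lt_nth_rowE x0) // H.
have [lt_p|le_p] := ltnP (bump_index r x) (size r); last exact: leq_trans le_p.
by rewrite -H // (lt_nth_rowE x0).
Qed.

Definition row_insert r x := set_nth x r (bump_index r x) x.

Lemma row_insertE x0 r x : row_insert r x = set_nth x0 r (bump_index r x) x.
Proof.
rewrite /row_insert !set_nthE; case: ltnP => // le_p.
by rewrite (_ : bump_index r x - size r = 0) //;
   apply/eqP; rewrite subn_eq0 bump_index_size.
Qed.

Lemma nth_row_insert x0 r x l :
  nth x0 (row_insert r x) l = if l == bump_index r x then x else nth x0 r l.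
Proof. by rewrite (row_insertE x0) nth_set_nth. Qed.

Lemma size_row_insert r x : size (row_insert r x) = maxn (bump_index r x).+1 (size r).
Proof. exact: size_set_nth. Qed.

Lemma size_row_insert_bump r x :
  bump_index r x < size r -> size (row_insert r x) = size r.
Proof. by rewrite size_row_insert => /maxn_idPr. Qed.

Lemma row_insert_rcons r x : bump_index r x = size r -> row_insert r x = rcons r x.
Proof. by rewrite /row_insert set_nthE => ->; rewrite ltnn subnn cats1. Qed.

Lemma row_insert_row r x : row r -> row (row_insert r x).
Proof.
move=> rr; apply/(row_leP x) => i j le_ij; rewrite size_row_insert => lt_j.
have lt_jr : j != bump_index r x -> j < size r.
  move: lt_j; rewrite leq_max ltnS => /orP[|//]; rewrite leq_eqVlt => /orP[->//|].
  by move=> lt_jp _; apply: leq_trans (bump_index_size r x).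
rewrite !nth_row_insert; case: eqVneq => [eq_i|ne_i]; case: eqVneq => [eq_j|ne_j] //.
- by apply: ltW; rewrite (lt_nth_rowE x rr (lt_jr ne_j)) -eq_i.
- have lt_i : i < bump_index r x by rewrite ltn_neqAle ne_i -eq_j.
  by rewrite leNgt (lt_nth_rowE x rr) -?ltnNge // (leq_trans lt_i) ?bump_index_size.
- by move/(row_leP x): rr; apply=> //; apply: lt_jr.
Qed.

(** The bumped entry moves weakly to the left when it goes down: the entry
    below it is larger, hence the leftmost entry of [h] exceeding it is not
    further right.  The columns then stay strict because every entry of the
    upper row up to the bumped position is at most [x], hence less than the
    bumped entry. *)
Lemma row_insert_dominates x0 r x h :
  row r -> row h -> dom r h -> bump_index r x < size r ->
  dom (row_insert r x) (row_insert h (nth x0 r (bump_index r x))).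
Proof.
move=> rr rh /(dominatesP _ x0)[le_hr dom_rh] lt_p; set y := nth x0 r _.
have lt_xy : (x < y)%O by rewrite /y lt_nth_rowE.
have le_qp : bump_index h y <= bump_index r x.
  have [lt_ph|le_hp] := ltnP (bump_index r x) (size h); last first.
    exact: leq_trans (bump_index_size _ _) le_hp.
  by rewrite -(lt_nth_rowE x0 rh lt_ph) dom_rh.
apply/(dominatesP _ x0); rewrite (size_row_insert_bump lt_p) size_row_insert.
split=> [|l lt_l]; first by rewrite geq_max le_hr (leq_ltn_trans le_qp).
rewrite !nth_row_insert; case: (eqVneq l (bump_index h y)) => [eq_l|ne_l].
  case: eqVneq => // ne_lp; apply: le_lt_trans lt_xy.
  have lt_lp : l < bump_index r x by rewrite ltn_neqAle ne_lp eq_l.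
  by rewrite leNgt (lt_nth_rowE x0 rr) -?ltnNge // (ltn_trans lt_lp).
have lt_lh : l < size h.
  move: lt_l; rewrite leq_max ltnS => /orP[|//]; rewrite leq_eqVlt (negPf ne_l).
  by move/leq_trans; apply; apply: bump_index_size.
case: eqVneq => [eq_lp|_]; last exact: dom_rh.
by apply: lt_trans lt_xy _; rewrite /y -eq_lp dom_rh.
Qed.

(** The position of the replaced entry can be read off the new row: it is the
    last one whose entry is less than the bumped letter.  If the positions
    differed, the larger one would hold in the new row both an entry less than
    the bumped letter and, by weak increase, one at least equal to it. *)
Lemma row_insert_inj x0 r1 r2 x1 x2 :
  row r1 -> row r2 -> bump_index r1 x1 < size r1 -> bump_index r2 x2 < size r2 ->
  row_insert r1 x1 = row_insert r2 x2 ->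
  nth x0 r1 (bump_index r1 x1) = nth x0 r2 (bump_index r2 x2) -> r1 = r2 /\ x1 = x2.
Proof.
wlog le_p : r1 r2 x1 x2 / bump_index r1 x1 <= bump_index r2 x2.
  move=> W; have [/W//|/ltnW/W H] := leqP (bump_index r1 x1) (bump_index r2 x2).
  by move=> *; case: H => // -> ->.
move=> rr1 rr2 lt1 lt2 eq_ins eq_y.
have eq_sz : size r1 = size r2.
  by have := congr1 size eq_ins; rewrite !size_row_insert_bump.
have eq_nth l : nth x0 (row_insert r1 x1) l = nth x0 (row_insert r2 x2) l.
  by rewrite eq_ins.
have eq_p : bump_index r1 x1 = bump_index r2 x2.
  apply/eqP; rewrite eqn_leq le_p leqNgt; apply/negP => lt_p.
  have := eq_nth (bump_index r2 x2); rewrite !nth_row_insert eqxx gtn_eqF // => eq_x2.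
  have := lt_nth_rowE x0 (x := x2) rr2 lt2; rewrite leqnn -eq_y -eq_x2.
  by rewrite ltNge; move/(row_leP x0): rr1 => -> //; rewrite ?eq_sz // ltnW.
split.
  apply: (@eq_from_nth _ x0) => // l lt_l.
  have [->|ne_l] := eqVneq l (bump_index r1 x1); first by rewrite eq_y eq_p.
  by have := eq_nth l; rewrite !nth_row_insert -eq_p (negPf ne_l).
by have := eq_nth (bump_index r1 x1); rewrite !nth_row_insert -eq_p eqxx.
Qed.

(** Reverse bumping: [y] goes back to the row above at the last position [i]
    whose entry is less than [y].  Such a position exists since [y] was
    inserted below an entry less than [y]; it is at least the index of [y] in
    the lower row, where [h] has entries greater than [y], so putting [y]
    there keeps the columns strict. *)
Lemma exists_row_insert x0 r' h y : row r' -> row h -> dom r' (row_insert h y) ->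
  exists r x, [/\ row r, dom r h, bump_index r x < size r,
                  nth x0 r (bump_index r x) = y & row_insert r x = r'].
Proof.
move=> rr' rh /(dominatesP _ x0)[le_hr dom_rh].
pose i := (find (fun z => (y <= z)%O) r').-1.
have find_gt l : l < size r' -> (nth x0 r' l < y)%O = (l < find (fun z => (y <= z)%O) r').
  move=> lt_l; case: ltnP => [/(before_find x0) /negbT|le_f]; first by rewrite -ltNge.
  apply/negbTE; rewrite -leNgt.
  apply: (@le_trans _ _ (nth x0 r' (find (fun z => (y <= z)%O) r'))).
    apply: (nth_find x0 (a := fun z => (y <= z)%O)).
    by rewrite has_find (leq_ltn_trans le_f).
  by move/(row_leP x0): rr'; apply.
have lt_q : bump_index h y < size r'.
  by apply: leq_trans le_hr; rewrite size_row_insert leq_maxl.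
have lt_q_find : bump_index h y < find (fun z => (y <= z)%O) r'.
  rewrite -find_gt //; have := dom_rh (bump_index h y); rewrite nth_row_insert eqxx.
  by apply; rewrite size_row_insert leq_maxl.
have lt_i l : (l < find (fun z => (y <= z)%O) r') = (l <= i).
  by rewrite /i; case: (find _ _) lt_q_find.
have le_qi : bump_index h y <= i by rewrite -lt_i.
have lt_ir : i < size r'.
  by apply: leq_trans (find_size (fun z => (y <= z)%O) r'); rewrite lt_i.
pose x := nth x0 r' i; pose r := set_nth x0 r' i y.
have lt_xy : (x < y)%O by rewrite find_gt // lt_i.
have size_r : size r = size r' by rewrite size_set_nth; apply/maxn_idPr.
have nth_r l : nth x0 r l = if l == i then y else nth x0 r' l.
  by rewrite nth_set_nth.
have le_r' := (row_leP x0 r').1 rr'.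
have rr : row r.
  apply/(row_leP x0) => a b le_ab; rewrite size_r !nth_r => lt_b.
  case: eqVneq => [eq_a|ne_a]; case: eqVneq => [eq_b|ne_b] //; last exact: le_r'.
    by rewrite leNgt find_gt // lt_i -ltnNge ltn_neqAle eq_sym ne_b -eq_a.
  apply: ltW; rewrite find_gt ?lt_i -?eq_b //; exact: leq_ltn_trans lt_b.
have pos_r : bump_index r x = i.
  apply: (bump_index_unique (x0 := x0)) => // [|l]; first by rewrite size_r ltnW.
  rewrite size_r nth_r => lt_l; case: eqVneq => [->|ne_l]; first by rewrite leqnn.
  case: leqP => [le_il|lt_li]; last by rewrite ltNge le_r' // ltnW.
  apply: lt_le_trans lt_xy _; rewrite leNgt find_gt // lt_i -ltnNge.
  by rewrite ltn_neqAle eq_sym ne_l.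
exists r, x; split=> //; rewrite ?pos_r ?size_r ?nth_r ?eqxx //.
  apply/(dominatesP _ x0); rewrite size_r; split=> [|l lt_l].
    by apply: leq_trans le_hr; rewrite size_row_insert leq_maxr.
  have lt_li : l < size (row_insert h y) by rewrite size_row_insert leq_max lt_l orbT.
  rewrite nth_r; case: eqVneq => [eq_l|ne_l].
    by rewrite (lt_nth_rowE x0 rh) ?eq_l // -eq_l.
  have := dom_rh l lt_li; rewrite nth_row_insert; case: eqVneq => // eq_l.
  move=> lt_ly; apply: lt_trans lt_ly _; by rewrite (lt_nth_rowE x0 rh) // eq_l.
apply: (@eq_from_nth _ x0) => [|l _].
  by rewrite size_row_insert_bump ?pos_r ?size_r.
by rewrite nth_row_insert pos_r nth_r; case: eqP => [->|].
Qed.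

End RowInsertion.

(** * Inserting a letter in a tableau *)

Section TableauInsertion.
Variables (disp : Order.disp_t) (A : orderType disp).
Implicit Types (r s : seq A) (t : seq (seq A)) (x y z : A).
Local Notation row := (sorted (@Order.le disp A)).
Local Notation dom := (dominates (@Order.lt disp A)).
Local Notation tab := (tab (@Order.le disp A) (@Order.lt disp A)).

Fixpoint insert t x : seq (seq A) :=
  if t is r :: t' then
    row_insert r x ::
      (if bump_index r x < size r then insert t' (nth x r (bump_index r x)) else t')
  else [:: [:: x]].

Fixpoint insert_row t x : nat :=
  if t is r :: t' then
    if bump_index r x < size r then (insert_row t' (nth x r (bump_index r x))).+1 else 0
  else 0.

(** What the next row becomes does not depend on whether it exists; this lets
    the row lemmas control the columns between two rows in an induction on
    tableaux. *)
Lemma head_insert t x : head [::] (insert t x) = row_insert (head [::] t) x.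
Proof. by case: t. Qed.

Lemma tab_head t : tab t -> row (head [::] t).
Proof. by case: t => //= r t /and4P[]. Qed.

Lemma row_insert_neq0 r x : row_insert r x != [::].
Proof. by rewrite -size_eq0 size_row_insert -lt0n leq_max. Qed.

Lemma bump_index_full r x : (bump_index r x < size r) = false -> bump_index r x = size r.
Proof.
by move/negbT; rewrite -leqNgt => le; apply/eqP; rewrite eqn_leq bump_index_size.
Qed.

Lemma insert_tab t x : tab t -> tab (insert t x).
Proof.
elim: t x => //= r t IHt x /and4P[r0 rr dom_r tt].
rewrite row_insert_neq0 row_insert_row //=; case: ifP => lt_p.
  by rewrite IHt // head_insert row_insert_dominates // tab_head.
rewrite tt andbT (row_insert_rcons (bump_index_full lt_p)).
move/(dominatesP _ x): dom_r => [le_sz dom_r]; apply/(dominatesP _ x).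
split=> [|l lt_l]; first by rewrite size_rcons ltnW.
by rewrite nth_rcons (leq_trans lt_l le_sz) dom_r.
Qed.

Lemma shape_insert t x : shape (insert t x) = incr_nth (shape t) (insert_row t x).
Proof.
elim: t x => //= r t IHt x; case: ifP => lt_p /=.
  by rewrite size_row_insert_bump // -IHt.
by rewrite size_row_insert (bump_index_full lt_p) (maxn_idPl _).
Qed.

Lemma insert_row_le t x : insert_row t x <= size t.
Proof. by elim: t x => //= r t IHt x; case: ifP => // _; apply: IHt. Qed.

Lemma perm_row_insert r x : bump_index r x < size r ->
  perm_eq (nth x r (bump_index r x) :: row_insert r x) (x :: r).
Proof.
move=> lt_p; apply/permP => a.
rewrite /row_insert set_nthE lt_p -[in RHS](cat_take_drop (bump_index r x) r).
rewrite (drop_nth x lt_p) /= !count_cat /=.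
by rewrite addnCA [RHS]addnCA [a x + (_ + _)]addnCA.
Qed.

Lemma perm_insert t x : perm_eq (flatten (insert t x)) (x :: flatten t).
Proof.
elim: t x => //= r t IHt x; case: ifP => lt_p; last first.
  by rewrite (row_insert_rcons (bump_index_full lt_p)) cat_rcons -cat1s perm_catCA.
set y := nth _ _ _.
have := perm_row_insert lt_p; rewrite -/y => perm_r.
apply: perm_trans (_ : perm_eq _ (row_insert r x ++ y :: flatten t)) _.
  by rewrite perm_cat2l.
by rewrite -cat1s perm_catCA cat1s -cat_cons -[x :: r ++ _]cat_cons perm_cat2r.
Qed.

Lemma insert_inj t1 t2 x1 x2 : tab t1 -> tab t2 ->
  insert t1 x1 = insert t2 x2 -> insert_row t1 x1 = insert_row t2 x2 ->
  t1 = t2 /\ x1 = x2.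
Proof.
elim: t1 t2 x1 x2 => [|r1 t1 IHt] [|r2 t2] x1 x2 //=.
- by move=> _ _ [->].
- move=> _ /and4P[r20 _ _ _]; case: ifP => // full [] eq_ins.
  have := congr1 size eq_ins; rewrite (row_insert_rcons (bump_index_full full)) size_rcons.
  by move=> [] /esym/size0nil r2nil; rewrite r2nil in r20.
- move=> /and4P[r10 _ _ _] _; case: ifP => // full [] eq_ins.
  have := congr1 size eq_ins; rewrite (row_insert_rcons (bump_index_full full)) size_rcons.
  by move=> [] /size0nil r1nil; rewrite r1nil in r10.
move=> /and4P[_ rr1 _ tt1] /and4P[_ rr2 _ tt2].
case: ifP => lt1; case: ifP => lt2 //.
  move=> [eq_ins eq_t] [eq_row]; have [-> eq_y] := IHt _ _ _ tt1 tt2 eq_t eq_row.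
  rewrite (set_nth_default x1 x2 lt2) in eq_y.
  by have [-> ->] := row_insert_inj rr1 rr2 lt1 lt2 eq_ins eq_y.
rewrite (row_insert_rcons (bump_index_full lt1)) (row_insert_rcons (bump_index_full lt2)).
move=> -[] /eqP; rewrite eqseq_rcons.
by case/andP=> /eqP-> /eqP-> ->.
Qed.

Lemma shape_nth0 t : nth 0 (shape t) 0 = size (head [::] t).
Proof. by case: t. Qed.

(** In the row of the corner the last cell is removed; going up, each row takes
    back the letter released by the row below. *)
Lemma exists_insert t' j : tab t' -> corner (shape t') j ->
  exists t x, [/\ tab t, insert t x = t' & insert_row t x = j].
Proof.
elim: t' j => [|r' t' IHt] j; first by rewrite /corner !nth_nil.
move=> /= /and4P[r'0 rr' dom_r' tt']; case: j => [|j]; last first.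
  move=> corner_j; have [t [y [tt ins_t row_t]]] := IHt _ tt' corner_j.
  move: dom_r'; rewrite -ins_t head_insert => dom_r'.
  have [r [x [rr dom_r lt_p nth_y ins_r]]] := exists_row_insert y rr' (tab_head tt) dom_r'.
  exists (r :: t), x; rewrite /= lt_p.
  rewrite (set_nth_default y x lt_p) nth_y ins_r row_t rr dom_r tt; split=> //.
  by rewrite -size_eq0 -lt0n (leq_ltn_trans _ lt_p).
rewrite /corner /= shape_nth0; case/lastP: r' => // r x in r'0 rr' dom_r' *.
rewrite size_rcons ltnS => le_hr.
have rr : row r := subseq_sorted le_trans (subseq_rcons r x) rr'.
have pos_r : bump_index r x = size r.
  apply: (bump_index_unique (x0 := x)) => // l lt_l.
  rewrite leqNgt lt_l /=; apply/negbTE; rewrite -leNgt.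
  have /(row_leP x)/(_ l (size r)) := rr'.
  by rewrite size_rcons !nth_rcons lt_l ltnn eqxx ltnW //; apply.
have [r_nil|r0] := eqVneq r [::].
  exists [::], x; split=> //=; rewrite r_nil /=.
  case: t' {IHt} tt' le_hr {dom_r'} => //= s t'.
  by rewrite r_nil leqn0 size_eq0 => /and4P[/negPf->].
exists (r :: t'), x; rewrite /= pos_r ltnn row_insert_rcons // r0 tt' andbT.
split=> //; rewrite rr /=.
move/(dominatesP _ x): dom_r' => [_ dom_r]; apply/(dominatesP _ x); split=> // l lt_l.
by have := dom_r l lt_l; rewrite nth_rcons (leq_trans lt_l le_hr).
Qed.

End TableauInsertion.

(** * Adding the largest entry to a standard tableau *)

Section AddCell.
Implicit Types (r s : seq nat) (t : seq (seq nat)) (j m : nat).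
Local Notation tab := (tab ltn ltn).

Fixpoint add_cell t j m : seq (seq nat) :=
  if t is r :: t' then
    if j is j'.+1 then r :: add_cell t' j' m else rcons r m :: t'
  else [:: [:: m]].

Lemma shape_add_cell t j m : j <= size t ->
  shape (add_cell t j m) = incr_nth (shape t) j.
Proof.
elim: t j => [|r t IHt] [|j] //= le_j; first by rewrite size_rcons.
by rewrite -IHt.
Qed.

Lemma perm_add_cell t j m : perm_eq (flatten (add_cell t j m)) (m :: flatten t).
Proof.
elim: t j => [|r t IHt] [|j] //=; first by rewrite cat_rcons -cat1s perm_catCA.
by rewrite -[m :: _]cat1s perm_sym perm_catCA perm_cat2l perm_sym IHt.
Qed.

Lemma head_add_cell t j m :
  head [::] (add_cell t j m) =
  if (j == 0) || (size t == 0) then rcons (head [::] t) m else head [::] t.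
Proof. by case: t j => [|r t] [|j]. Qed.

(** A strict maximum can be put in any cell whose addition leaves a partition
    shape, the shape condition being what puts an entry above the new cell. *)
Lemma add_cell_tab t j m : all (gtn m) (flatten t) ->
  sorted geq (shape (add_cell t j m)) -> tab t -> tab (add_cell t j m).
Proof.
elim: t j => //= r t IHt [|j] /=; rewrite all_cat => /andP[/allP r_m t_m].
  move=> _ /and4P[r0 rr dom_r tt].
  rewrite tt andbT -size_eq0 size_rcons /=; apply/andP; split.
    rewrite (sorted_pairwise ltn_trans) pairwise_rcons -(sorted_pairwise ltn_trans) rr andbT.
    exact/allP.
  move/(dominatesP _ 0): dom_r => [le_sz dom_r]; apply/(dominatesP _ 0).
  split=> [|l lt_l]; first by rewrite size_rcons ltnW.
  by rewrite nth_rcons (leq_trans lt_l le_sz) dom_r.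
move=> sh /and4P[-> -> dom_r tt] /=; rewrite IHt ?(path_sorted sh) // andbT.
have le_h : size (head [::] (add_cell t j m)) <= size r.
  by case: (add_cell t j m) sh => //= s u /andP[].
move: le_h; rewrite head_add_cell; case: ifP => // _; rewrite size_rcons => lt_hr.
move/(dominatesP _ 0): dom_r => [le_sz dom_r]; apply/(dominatesP _ 0).
rewrite size_rcons; split=> // l; rewrite ltnS leq_eqVlt nth_rcons.
case/predU1P=> [->|lt_l]; last by rewrite lt_l dom_r.
by rewrite ltnn eqxx; apply: r_m; apply: mem_nth.
Qed.

Lemma add_cell_inj t1 t2 j1 j2 m : m \notin flatten t1 -> m \notin flatten t2 ->
  [::] \notin t1 -> [::] \notin t2 -> j1 <= size t1 -> j2 <= size t2 ->
  add_cell t1 j1 m = add_cell t2 j2 m -> t1 = t2 /\ j1 = j2.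
Proof.
have rconsF r s : m \notin s -> rcons r m = s -> False.
  by move=> m_s eq_s; rewrite -eq_s mem_rcons inE eqxx in m_s.
elim: t1 t2 j1 j2 => [|r1 t1 IHt] [|r2 t2] [|j1] [|j2] //=;
  rewrite ?inE ?mem_cat ?negb_or.
- by case: r2 => [|a [|b r2]].
- by move=> _ /andP[m_r _] _ _ _ _ [] /(rconsF [::]).
- by case: r1 => [|a [|b r1]].
- by move=> /andP[m_r _] _ _ _ _ _ [] /esym/(rconsF [::]).
- by move=> _ _ _ _ _ _ [] /rcons_inj[-> ->].
- by move=> _ /andP[m_r _] _ _ _ _ [] /rconsF.
- by move=> /andP[m_r _] _ _ _ _ _ [] /esym/rconsF.
move=> /andP[_ m1] /andP[_ m2] /andP[_ n1] /andP[_ n2] le1 le2 [-> eq_t].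
by have [-> ->] := IHt _ _ _ m1 m2 n1 n2 le1 le2 eq_t.
Qed.

(** The maximum has no entry to its right or below it, since that entry would
    be larger; hence it sits at a corner. *)
Lemma exists_add_cell t m : tab t -> all (geq m) (flatten t) -> m \in flatten t ->
  exists t' j, [/\ tab t', j <= size t', add_cell t' j m = t & corner (shape t) j].
Proof.
elim: t => //= r t IHt /and4P[r0 rr dom_r tt]; rewrite all_cat mem_cat => /andP[r_m t_m].
have [m_r _|_ /= m_t] := boolP (m \in r); last first.
  have [t' [j [tt' le_j add_t' corner_j]]] := IHt tt t_m m_t.
  exists (r :: t'), j.+1; rewrite /= add_t' r0 rr tt'; split=> //; rewrite andbT.
  move/(dominatesP _ 0): dom_r => [le_sz dom_r]; apply/(dominatesP _ 0).
  move: le_sz dom_r; rewrite -add_t' head_add_cell; case: ifP => // _.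
  rewrite size_rcons => lt_sz dom_r; split=> [|l lt_l]; first exact: ltnW.
  by have := dom_r l (ltnW lt_l); rewrite nth_rcons lt_l.
case/lastP: r => // r x in r0 rr dom_r r_m m_r *.
have [rr' r_x] : sorted ltn r /\ all (gtn x) r.
  by move: rr; rewrite !(sorted_pairwise ltn_trans) pairwise_rcons => /andP[].
have eq_x : x = m.
  move: r_m m_r; rewrite all_rcons mem_rcons inE => /andP[/= le_xm _] /predU1P[//|m_r].
  by have /= := allP r_x m m_r; rewrite ltnNge le_xm.
subst x.
have lt_hr : size (head [::] t) < (size r).+1.
  move/(dominatesP _ 0): dom_r => [le_sz dom_r]; rewrite ltnS leqNgt; apply/negP => lt_sz.
  have := dom_r _ lt_sz; rewrite nth_rcons ltnn eqxx /= ltnNge => /negP; apply.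
  case: t t_m lt_sz {IHt dom_r le_sz tt} => //= s t.
  rewrite all_cat => /andP[/allP s_m _] lt_sz.
  by apply: s_m; apply: mem_nth.
have dom_r' : dominates ltn r (head [::] t).
  move/(dominatesP _ 0): dom_r => [_ dom_r]; apply/(dominatesP _ 0); split=> // l lt_l.
  by have := dom_r l lt_l; rewrite nth_rcons (leq_trans lt_l lt_hr).
have corner0 : corner (shape (rcons r m :: t)) 0.
  by rewrite /corner /= shape_nth0 size_rcons.
have [r_nil|rn0] := eqVneq r [::].
  exists [::], 0; split=> //; rewrite r_nil /= in lt_hr *.
  case: t lt_hr tt {IHt t_m dom_r dom_r' corner0} => //= s t.
  by rewrite ltnS leqn0 size_eq0 => /eqP->.
by exists (r :: t), 0; rewrite /= rn0 rr' dom_r'.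
Qed.

End AddCell.

(** * The Robinson-Schensted-Knuth correspondence *)

Section RSK.
Variables (disp : Order.disp_t) (A : orderType disp).
Implicit Types (w : seq A) (x y z : A).
Local Notation tabA := (tab (@Order.le disp A) (@Order.lt disp A)).
Local Notation tabN := (tab ltn ltn).

(** Letters are inserted from the last to the first, so that the most recent
    insertion is at the head of the word, where induction undoes it. *)
Fixpoint rsk w : seq (seq nat) * seq (seq A) :=
  if w is x :: w' then
    let: (Q, P) := rsk w' in
    (add_cell Q (insert_row P x) (size w), insert P x)
  else ([::], [::]).

Lemma is_standard_tableauE n S :
  is_standard_tableau n S = tabN S && perm_eq (flatten S) (iota 1 n).
Proof. by rewrite /is_standard_tableau is_tableauE. Qed.

Lemma perm_iota_max n : perm_eq (iota 1 n.+1) (n.+1 :: iota 1 n).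
Proof. by rewrite -{1}(addn1 n) iotaD cats1 perm_rcons. Qed.

Lemma insert_row_le_shape (Q : seq (seq nat)) (P : seq (seq A)) x :
  shape Q = shape P -> insert_row P x <= size Q.
Proof. by move/(congr1 size); rewrite !size_map => ->; apply: insert_row_le. Qed.

Lemma rsk_spec w :
  [/\ shape (rsk w).1 = shape (rsk w).2, is_standard_tableau (size w) (rsk w).1,
      tabA (rsk w).2 & perm_eq (flatten (rsk w).2) w].
Proof.
elim: w => [|x w] //=; case: (rsk w) => S T /= [sh_ST std_S tT perm_T].
have [tS perm_S] : tabN S /\ perm_eq (flatten S) (iota 1 (size w)).
  by apply/andP; rewrite -is_standard_tableauE.
have sh' : shape (add_cell S (insert_row T x) (size w).+1) = shape (insert T x).
  by rewrite shape_add_cell ?insert_row_le_shape // sh_ST shape_insert.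
have tT' := insert_tab x tT.
split=> //; last by apply: perm_trans (perm_insert _ _) _; rewrite perm_cons.
rewrite is_standard_tableauE; apply/andP; split.
  apply: add_cell_tab => //.
    rewrite (perm_all _ perm_S); apply/allP => i; rewrite mem_iota add1n.
    by case/andP.
  by rewrite sh'; case/andP: (tab_shape tT').
apply: perm_trans (perm_add_cell _ _ _) _.
by rewrite perm_sym (perm_trans (perm_iota_max _)) // perm_cons perm_sym.
Qed.

Lemma tab_no_nil_row S : tabN S -> [::] \notin S.
Proof. by elim: S => //= r S IHS /and4P[r0 _ _ /IHS]; rewrite inE eq_sym (negPf r0). Qed.

Lemma rsk_inj w1 w2 : size w1 = size w2 -> rsk w1 = rsk w2 -> w1 = w2.
Proof.
elim: w1 w2 => [|x1 w1 IHw] [|x2 w2] //= [eq_sz].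
have [] := rsk_spec w1; have [] := rsk_spec w2; move: (IHw w2 eq_sz).
case: (rsk w1) => S1 T1; case: (rsk w2) => S2 T2 /= {}IHw.
rewrite !is_standard_tableauE eq_sz => sh2 /andP[tS2 perm2] tT2 _ sh1 /andP[tS1 perm1] tT1 _.
have max_new S : perm_eq (flatten S) (iota 1 (size w2)) -> (size w2).+1 \notin flatten S.
  by move=> perm_S; rewrite (perm_mem perm_S) mem_iota add1n ltnn andbF.
case=> eq_S eq_T.
have [eq_S' eq_row] := add_cell_inj (max_new _ perm1) (max_new _ perm2)
  (tab_no_nil_row tS1) (tab_no_nil_row tS2)
  (insert_row_le_shape x1 sh1) (insert_row_le_shape x2 sh2) eq_S.
have [eq_T' ->] := insert_inj tT1 tT2 eq_T eq_row.
by rewrite IHw // eq_S' eq_T'.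
Qed.

Lemma exists_rsk n S T : shape S = shape T -> is_standard_tableau n S -> tabA T ->
  exists2 w, size w = n & rsk w = (S, T).
Proof.
elim: n S T => [|n IHn] S T sh_ST; rewrite is_standard_tableauE => /andP[tS perm_S] tT.
  exists [::] => //=.
  have S_nil : S = [::].
    case: S tS perm_S {sh_ST} => //= r S /andP[r0 _] /perm_size /eqP.
    by rewrite size_cat addn_eq0 size_eq0 (negPf r0).
  by move: sh_ST; rewrite S_nil; case: (T).
have le_S : all (geq n.+1) (flatten S).
  rewrite (perm_all _ perm_S); apply/allP => i; rewrite mem_iota add1n ltnS.
  by case/andP.
have max_S : n.+1 \in flatten S by rewrite (perm_mem perm_S) mem_iota add1n ltnSn.
have [S' [j [tS' le_j add_S' corner_j]]] := exists_add_cell tS le_S max_S.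
rewrite sh_ST in corner_j; have [T' [x [tT' ins_T' row_T']]] := exists_insert tT corner_j.
have sh' : shape S' = shape T'.
  have [/andP[_ S'0] /andP[_ T'0]] := (tab_shape tS', tab_shape tT').
  apply: (incr_nth_partition_inj (j := j)) => //.
  by rewrite -(shape_add_cell n.+1 le_j) add_S' sh_ST -ins_T' shape_insert row_T'.
have std_S' : is_standard_tableau n S'.
  rewrite is_standard_tableauE tS' -(perm_cons n.+1) /=.
  apply: perm_trans (perm_iota_max n); apply: perm_trans perm_S.
  by rewrite -add_S' perm_sym perm_add_cell.
have [w size_w rsk_w] := IHn _ _ sh' std_S' tT'.
by exists (x :: w); rewrite /= ?rsk_w ?size_w // row_T' add_S' ins_T'.
Qed.

End RSK.

(** * Graded lexicographic order on multisets *)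

Section GradedLexOrder.
Variable k : nat.
Implicit Types M N : {mset 'I_k}.

Lemma mset_word_inj : injective (@mset_word k).
Proof.
move=> M N /(perm_sortP le_total le_trans le_anti)/eq_seq_msetP.
by rewrite !seq_mset_id.
Qed.

Lemma grlex_lt_irr : irreflexive (@grlex_lt k).
Proof. by move=> M; rewrite /grlex_lt ltnn eqxx ltxx. Qed.

Lemma grlex_lt_trans : transitive (@grlex_lt k).
Proof.
rewrite /grlex_lt => N M P /orP[lt_MN|/andP[/eqP-> lt_MN]] /orP[lt_NP|/andP[/eqP eq_NP lt_NP]].
- by rewrite (ltn_trans lt_MN).
- by rewrite -eq_NP lt_MN.
- by rewrite lt_NP.
- by rewrite eq_NP eqxx (lt_trans lt_MN) // orbT.
Qed.

Lemma grlex_le_total : total (@grlex_le k).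
Proof.
move=> M N; rewrite /grlex_le /grlex_lt; case: ltngtP => _; rewrite ?orbT //=.
by case: (ltgtP (mset_word M) (mset_word N)) => [||/mset_word_inj->]; rewrite ?orbT ?eqxx.
Qed.

End GradedLexOrder.

Fact grlex_display : Order.disp_t. Proof. exact: Order.Disp tt tt. Qed.

(** An alias, to carry the graded lexicographic order without competing with
    other orders on multisets. *)
Definition grmset k := {mset 'I_k}.
HB.instance Definition _ k := Choice.on (grmset k).
HB.instance Definition _ k :=
  Order.LtLe_isPOrder.Build grlex_display (grmset k)
    (fun _ _ => erefl) (@grlex_lt_irr k) (@grlex_lt_trans k).
HB.instance Definition _ k :=
  Order.POrder_isTotal.Build grlex_display (grmset k) (@grlex_le_total k).

(** * Words as sequences of disjoint blocks *)

Section Blocks.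
Variables n k : nat.
Implicit Type u : k.-tuple 'I_n.

Definition blocks u : seq (grmset k) :=
  [seq seq_mset [seq i <- enum 'I_k | tnth u i == j] | j <- enum 'I_n].

Lemma size_blocks u : size (blocks u) = n.
Proof. by rewrite size_map size_enum_ord. Qed.

Lemma nth_blocks u (j : 'I_n) i : (nth mset0 (blocks u) j : {mset _}) i = (tnth u i == j).
Proof.
rewrite (nth_map j) ?size_enum_ord // nth_ord_enum mset_seqE.
rewrite count_uniq_mem; last exact/filter_uniq/enum_uniq.
by rewrite mem_filter mem_enum andbT.
Qed.

Lemma mset_sumE (s : seq {mset 'I_k}) i :
  (\big[msetD/mset0]_(M <- s) M) i = \sum_(M <- s) M i.
Proof.
by elim/big_rec2: _ => [|M a N _ <-]; rewrite ?mset0E // msetE2.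
Qed.

Lemma mset_content_enumP (w : seq {mset 'I_k}) T : size w = n -> perm_eq (flatten T) w ->
  reflect (forall i, \sum_(j < n) nth mset0 w j i = 1)
          (mset_content T == seq_mset (enum 'I_k)).
Proof.
move=> size_w perm_T; apply: (iffP mset_eqP) => H i; have := H i.
  rewrite mset_sumE (perm_big _ perm_T) /= (big_nth mset0) size_w big_mkord => ->.
  by rewrite mset_seqE count_uniq_mem ?enum_uniq // mem_enum.
rewrite mset_sumE (perm_big _ perm_T) /= (big_nth mset0) size_w big_mkord => ->.
by rewrite mset_seqE count_uniq_mem ?enum_uniq // mem_enum.
Qed.

Lemma sum_nth_blocks u i : \sum_(j < n) (nth mset0 (blocks u) j : {mset _}) i = 1.
Proof.
rewrite (bigD1 (tnth u i)) //= nth_blocks eqxx big1 // => j ne_j.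
by rewrite nth_blocks eq_sym (negPf ne_j).
Qed.

Lemma blocks_inj : injective blocks.
Proof.
move=> u v eq_uv; apply: eq_from_tnth => i; apply/esym/eqP.
by have := nth_blocks u (tnth u i) i; rewrite eq_uv nth_blocks eqxx; case: eqP.
Qed.

(** Multiplicities are natural numbers summing to 1, so each letter lies in
    exactly one block, once. *)
Lemma exists_blocks (w : seq (grmset k)) : size w = n ->
  (forall i, \sum_(j < n) (nth mset0 w j : {mset _}) i = 1) -> exists u, blocks u = w.
Proof.
move=> size_w w1.
have /fin_all_exists[f fP] i : exists j : 'I_n, forall j' : 'I_n,
    (nth mset0 w j' : {mset _}) i = (j == j').
  have /eqP/sum_nat_eq1[j [_ w_j w_j']] := w1 i; exists j => j'.
  by case: eqVneq => [<-|ne_j] //; rewrite w_j' // eq_sym.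
exists (mktuple f); apply: (@eq_from_nth _ mset0) => [|j]; rewrite size_blocks ?size_w // => lt_j.
apply/msetP => i; rewrite (nth_blocks _ (Ordinal lt_j)) tnth_mktuple.
by rewrite -fP.
Qed.

End Blocks.

Theorem corollary5p4 (n k : nat) (n_gt0 : 0 < n) (k_gt0 : 0 < k) :
  exists f : k.-tuple 'I_n -> tableau_pair n k, bijective f.
Proof.
have valid (u : k.-tuple 'I_n) :
  [&& shape (rsk (blocks u)).1 == shape (rsk (blocks u)).2,
        is_standard_tableau n (rsk (blocks u)).1 &
        is_standard_mset_tableau (rsk (blocks u)).2].
  have [-> + tT perm_T] := rsk_spec (blocks u); rewrite size_blocks eqxx => -> /=.
  apply/andP; split; first by rewrite /is_semistandard_mset_tableau is_tableauE.
  by apply/(mset_content_enumP (size_blocks u) perm_T) => i; apply: sum_nth_blocks.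
pose f u : tableau_pair n k := exist _ (rsk (blocks u)) (valid u).
have f_inj : injective f.
  by move=> u v [eq_uv]; apply/blocks_inj/rsk_inj => //; rewrite !size_blocks.
have f_surj ST : exists u, f u == ST.
  case: ST => -[S T] /= ST_ok; have /and3P[/eqP/= sh_ST std_S /andP[]] := ST_ok.
  rewrite /is_semistandard_mset_tableau is_tableauE => tT content_T.
  have [w size_w rsk_w] :=
    exists_rsk (A := grmset k) sh_ST std_S tT.
  have [_ _ _ perm_T] := rsk_spec w; rewrite rsk_w /= in perm_T.
  have [u blocks_u] := exists_blocks size_w (elimT (mset_content_enumP size_w perm_T) content_T).
  by exists u; apply/eqP/val_inj; rewrite /= blocks_u.
exists f; exists (fun ST => xchoose (f_surj ST)) => [u|ST].
  by apply: f_inj; apply/eqP/(xchooseP (f_surj (f u))).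
by apply/eqP/(xchooseP (f_surj ST)).
Qed.
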